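(* Let $V$ and $W_1,\dots,W_J$ be real Hilbert spaces, $B_j\colon V\to W_j$ bounded linear operators, $G_j\colon W_j\to\overline{\mathbb{R}}$ proper, convex, and lower semicontinuous functions ($1\le j\le J$), and $F\colon V\to\mathbb{R}$ a Fr\'echet differentiable convex function that is strongly convex and smooth. Consider the primal problem $$\min_{v\in V}\Big\{F(v)+\sum_{j=1}^JG_j(B_jv)\Big\}\qquad(\mathrm{P})$$ and its dual problem $$\min_{q_j\in W_j^*}\Big\{F^*\Big(-\sum_{j=1}^JB_j^*q_j\Big)+\sum_{j=1}^JG_j^*(q_j)\Big\}.\qquad(\mathrm{D})$$ The dualization-based Peaceman--Rachford splitting algorithm for (P): choose $u^{(0)}\in V$ and $(r_1^{(0)},\dots,r_J^{(0)})\in(V^* )^J$, and for $n=0,1,2,\dots$ and $j=1,2,\dots,J$ successively set $$u^{(n+\frac{j}{J})}=\arg\min_{v\in V}\Big\{D_F(v;u^{(n+\frac{j-1}{J})})+(r_j^{(n)},v)+G_j(B_jv)\Big\},$$ $$r_j^{(n+1)}=r_j^{(n)}+F'(u^{(n+\frac{j}{J})})-F'(u^{(n+\frac{j-1}{J})}),$$ is a dualization of the successive subspace correction method (SSC) for (D): choose $(p_1^{(0)},\dots,p_J^{(0)})\in\prod_{j=1}^JW_j^*$, and for $n=0,1,2,\dots$ and $j=1,\dots,J$ successively take $$p_j^{(n+1)}\in\arg\min_{q_j\in W_j^*}\Big\{F^*\Big(-B_j^*q_j-\sum_{i=1}^{j-1}B_i^*p_i^{(n+1)}-\sum_{i=j+1}^JB_i^*p_i^{(n)}\Big)+G_j^*(q_j)\Big\}.$$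 More precisely, if $$u^{(0)}=(F^* )'\Big(-\sum_{j=1}^JB_j^*p_j^{(0)}\Big),\quad r_j^{(0)}=-B_j^*p_j^{(0)},\quad 1\le j\le J,$$ then $$u^{(n)}=(F^* )'\Big(-\sum_{j=1}^JB_j^*p_j^{(n)}\Big),\quad r_j^{(n)}=-B_j^*p_j^{(n)},\quad 1\le j\le J,\ n\ge1.$$
   Context: Notation: $\overline{\mathbb{R}}=\mathbb{R}\cup\{\pm\infty\}$; $V^*$, $W_j^*$ are dual spaces; $(\cdot,\cdot)$ denotes inner products and duality pairings; $B_j^*\colon W_j^*\to V^*$ is the adjoint. The conjugate is $F^*(q)=\sup_{v\in V}\{(q,v)-F(v)\}$, $q\in V^*$; similarly $G_j^*$ on $W_j^*$. The Bregman divergence is $D_F(v;w)=F(v)-F(w)-(F'(w),v-w)$. $F$ strongly convex: for some $\mu>0$, $F(v)\ge F(w)+(F'(w),v-w)+\frac{\mu}{2}\|v-w\|^2$ for all $v,w\in V$. $F$ smooth: for some $L>0$, $\|F'(v)-F'(w)\|\le L\|v-w\|$ for all $v,w\in V$. Under these assumptions $F'\colon V\to V^*$ is invertible with inverse $(F^* )'\colon V^*\to V$. Dualization (definition): a method $\{u^{(n)}\}$ for (P) is a dualization of a method $\{(p_1^{(n)},\dots,p_J^{(n)})\}$ for (D) if, for any initial configuration of the dual algorithm, there exists an initial configuration of the primal algorithm such that $-\sum_{j=1}^JB_j^*p_j^{(n)}\in\partial F(u^{(n)})=\{F'(u^{(n)})\}$ for all $n\ge1$. Standing assumptions: every minimization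 subproblem defining an iterate through an $\arg\min$ admits a solution; and whenever Fenchel--Rockafellar duality is used (for (P)/(D) and for the corresponding pairs of local subproblems), the strong duality qualification condition holds: for a problem $\min_{v}\{\Phi(v)+\Gamma(Bv)\}$, the function $w\mapsto\inf_{v}\{\Phi(v)+\Gamma(Bv+w)\}$ is subdifferentiable (has nonempty subdifferential) at $w=0$. *)

(* Defs.v *)
From HB Require Import structures.
From mathcomp Require Import all_boot all_order all_algebra.
From mathcomp Require Import all_classical all_reals all_analysis.

Set Implicit Arguments.
Unset Strict Implicit.
Unset Printing Implicit Defensive.

Import Order.TTheory GRing.Theory Num.Theory.
Import numFieldNormedType.Exports.

Local Open Scope classical_set_scope.
Local Open Scope ring_scope.

HB.mixin Record NormedModule_isHilbert (R : realType) V
    & CompleteNormedModule R V := {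
  inner : {dot V for idfun} ;
  inner_norm : forall x : V, inner x x = `|x| ^+ 2
}.

#[short(type="hilbertType")]
HB.structure Definition Hilbert (R : realType) :=
  {V of CompleteNormedModule R V & NormedModule_isHilbert R V}.

Section bounded_linear_operators.
Context {R : realType}.
Variables V W : normedModType R.

Definition bounded_linear : {pred V -> W} :=
  [pred f : V -> W | `[< linear f /\ continuous f >]].

(* For a linear map, boundedness is continuity (linear_bounded_continuous). *)
Record blin := BLin {
  blin_fun :> V -> W ;
  blinP : blin_fun \in bounded_linear
}.

HB.instance Definition _ := [isSub for blin_fun].
HB.instance Definition _ := [Choice of blin by <:].

Lemma blin_linear (f : blin) : linear f.
Proof. by have := blinP f; rewrite inE => -[]. Qed.

Lemma blin_continuous (f : blin) : continuous f.
Proof. by have := blinP f; rewrite inE => -[]. Qed.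

HB.instance Definition _ (f : blin) :=
  GRing.isLinear.Build R V W *:%R (blin_fun f) (blin_linear f).

Lemma bounded_linear_submod_closed : submod_closed bounded_linear.
Proof.
split.
  rewrite inE; split=> [a x y|]; first by rewrite scaler0 addr0.
  exact: cst_continuous.
move=> a f g /[!inE] -[lf cf] [lg cg]; split.
  move=> b x y; rewrite !fctE lf lg scalerDr scalerDr !scalerA (mulrC a b).
  by rewrite addrACA.
move=> x; apply: cvgD; last exact: cg.
by apply: cvgZr; exact: cf.
Qed.

HB.instance Definition _ := GRing.isSubmodClosed.Build R (V -> W)
  bounded_linear bounded_linear_submod_closed.
HB.instance Definition _ := [SubChoice_isSubLmodule of blin by <:].

Definition opnorm (f : blin) : R := sup [set `|f x| | x in [set x | `|x| <= 1]].

Lemma opnorm_has_sup (f : blin) :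
  has_sup [set `|f x| | x in [set x | `|x| <= 1]].
Proof.
split; first by exists `|f 0|; exists 0 => //=; rewrite normr0.
have /bounded_funP/(_ 1)[M fM] : bounded_near f (nbhs (0 : V)).
  exact/linear_bounded_continuous/blin_continuous.
by exists M => _ [x x1 <-]; exact: fM.
Qed.

Lemma opnorm_ub (f : blin) (x : V) : `|x| <= 1 -> `|f x| <= opnorm f.
Proof.
by move=> x1; apply: (sup_upper_bound (opnorm_has_sup f)); exists x.
Qed.

Lemma opnorm_le (f : blin) (M : R) :
  (forall x : V, `|x| <= 1 -> `|f x| <= M) -> opnorm f <= M.
Proof.
move=> fM; apply: ge_sup; first exact: (opnorm_has_sup f).1.
by move=> _ [x x1 <-]; exact: fM.
Qed.

Lemma opnormD (f g : blin) : opnorm (f + g) <= opnorm f + opnorm g.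
Proof.
apply: opnorm_le => x x1; rewrite /= (le_trans (ler_normD _ _))//.
by rewrite lerD// opnorm_ub.
Qed.

Lemma opnorm_ge0 (f : blin) : 0 <= opnorm f.
Proof. by apply: (le_trans (normr_ge0 (f 0))); rewrite opnorm_ub ?normr0. Qed.

Lemma opnormZ_le (a : R) (f : blin) : opnorm (a *: f) <= `|a| * opnorm f.
Proof.
by apply: opnorm_le => x x1; rewrite /= normrZ ler_wpM2l// opnorm_ub.
Qed.

Lemma opnormZ (a : R) (f : blin) : opnorm (a *: f) = `|a| * opnorm f.
Proof.
apply/eqP; rewrite eq_le opnormZ_le/=.
have [->|a0] := eqVneq a 0; first by rewrite normr0 mul0r opnorm_ge0.
rewrite -ler_pdivlMl ?normr_gt0// -normfV.
by rewrite -{1}[f](scalerK a0) opnormZ_le.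
Qed.

Lemma opnorm0_eq0 (f : blin) : opnorm f = 0 -> f = 0.
Proof.
move=> f0; apply/val_inj/funext => x /=.
have [->|x0] := eqVneq x 0; first by rewrite linear0.
have : `|f (`|x|^-1 *: x)| <= 0.
  by rewrite -f0 opnorm_ub// normrZ normfV normr_id mulVf// normr_eq0.
by rewrite normr_le0 linearZ/= scaler_eq0 invr_eq0 normr_eq0 (negbTE x0) => /eqP.
Qed.

HB.instance Definition _ :=
  Lmodule_isNormed.Build R blin opnormD opnormZ opnorm0_eq0.

End bounded_linear_operators.

Definition topdual {R : realType} (V : normedModType R) := blin V R^o.

Section adjoint.
Context {R : realType} {V W : normedModType R}.

Lemma adjoint_subproof (B : blin V W) (q : topdual W) :
  (q \o B : V -> R^o) \in @bounded_linear R V R^o.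
Proof.
rewrite inE; split=> [a x y|x]; first by rewrite /= !linearP.
by apply: continuous_comp; exact: blin_continuous.
Qed.

Definition adjoint (B : blin V W) (q : topdual W) : topdual V :=
  BLin (adjoint_subproof B q).

End adjoint.

Section convex_analysis.
Context {R : realType} {V : normedModType R}.
Local Open Scope ereal_scope.

(* The Frechet derivative F'(v) as an element of the dual; 0 (a default value)
   where F is not differentiable. *)
Definition dualdiff (F : V -> R) (v : V) : topdual V :=
  insubd (0%R : topdual V) ('d (F : V -> R^o) v : V -> R^o).

Definition strongly_convex (F : V -> R) := exists2 mu : R, (0 < mu)%R &
  forall v w : V,
    (F w + dualdiff F w (v - w) + mu / 2 * `|v - w| ^+ 2 <= F v)%R.

Definition smooth (F : V -> R) := exists2 L : R, (0 < L)%R &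
  forall v w : V, (`|dualdiff F v - dualdiff F w| <= L * `|v - w|)%R.

Definition proper_function (f : V -> \bar R) :=
  (forall v, f v != -oo) /\ (exists v, f v != +oo).

(* Only meant for functions that do not take the value -oo; note that
   0 * +oo = 0 in \bar R. *)
Definition econvex (f : V -> \bar R) := forall (t : R) (x y : V),
  (0 <= t <= 1)%R ->
  f (t *: x + (1 - t) *: y)%R <= t%:E * f x + (1 - t)%:E * f y.

Definition conjugate (f : V -> \bar R) (q : topdual V) : \bar R :=
  ereal_sup [set (q v)%:E - f v | v in [set: V]].

Definition subdifferential (f : V -> \bar R) (x : V) : set (topdual V) :=
  [set p | f x \is a fin_num /\ forall y, f x + (p (y - x)%R)%:E <= f y].

Definition is_argmin {T : Type} (f : T -> \bar R) (x : T) :=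
  forall y, f x <= f y.

(* u is the derivative at q of the conjugate of F: the conjugate is finite near
   q and Frechet differentiable at q, and its derivative, a functional on the
   dual of V, is the evaluation at u (V being identified with its bidual). *)
Definition is_conjdiff (F : V -> R) (q : topdual V) (u : V) :=
  (\forall p \near q, conjugate (EFin \o F) p \is a fin_num) /\
  is_diff q (fine \o conjugate (EFin \o F) : topdual V -> R^o)
            (fun p : topdual V => p u).

Definition bregman (F : V -> R) (v w : V) : R :=
  (F v - F w - dualdiff F w (v - w))%R.

End convex_analysis.

(* The qualification condition for min_v { Phi v + Gam (B v) }. *)
Definition qualified {R : realType} {V W : normedModType R} (Phi : V -> \bar R)
    (Gam : W -> \bar R) (B : blin V W) :=
  subdifferential
    (fun w => ereal_inf [set Phi v + Gam (B v + w)%R | v in [set: V]]%E) 0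
  !=set0.

(* An algorithm: from an initial configuration it generates sequences of
   iterates in S (possibly several, if minimizers are not unique). *)
Record method (S : Type) := Method {
  config : Type ;
  generates : config -> (nat -> S) -> Prop
}.

Section algorithms.
Context {R : realType} {V : hilbertType R} {J : nat}.
Context {W : 'I_J -> hilbertType R}.
Variables (F : V -> R) (G : forall j, W j -> \bar R).
Variable B : forall j, blin V (W j).
Arguments G : clear implicits.
Local Open Scope ereal_scope.

(* The qualification condition for min_v { F v + \sum_j G j (B j v) };
   perturbations and subgradients range over the product of the W j, resp. of
   their duals. *)
Definition primal_qualified :=
  let h (w : forall j, W j) := ereal_inf
    [set (F v)%:E + \sum_(j < J) G j (B j v + w j)%R | v in [set: V]] in
  let w0 : forall j, W j := fun j => 0%R in
  h w0 \is a fin_num /\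
  exists p : forall j, topdual (W j),
    forall w, h w0 + (\sum_(j < J) p j (w j))%R%:E <= h w.

Definition neg_adjoint_sum (p : forall j, topdual (W j)) : topdual V :=
  (- \sum_(j < J) adjoint (B j) (p j))%R.

Definition prs_smooth_part (u : V) (rj : topdual V) (v : V) : \bar R :=
  (bregman F v u + rj v)%:E.

Definition prs_objective (j : 'I_J) (u : V) (rj : topdual V) (v : V) : \bar R :=
  prs_smooth_part u rj v + G j (B j v).

(* The iterate u^(n + j/J) is u (n * J + j); the index j : 'I_J starts at 0. *)
Definition prs_run (u : nat -> V) (r : nat -> 'I_J -> topdual V) :=
  forall (n : nat) (j : 'I_J),
    is_argmin (prs_objective j (u (n * J + j)%N) (r n j))
      (u (n * J + j.+1)%N) /\
    r n.+1 j = (r n j + dualdiff F (u (n * J + j.+1)%N)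
                      - dualdiff F (u (n * J + j)%N))%R.

(* pnew i is used for i < j and pold i for i > j. *)
Definition ssc_objective (j : 'I_J) (pnew pold : forall i, topdual (W i))
    (q : topdual (W j)) : \bar R :=
  conjugate (EFin \o F)
    (- adjoint (B j) q - \sum_(i < J | (i < j)%N) adjoint (B i) (pnew i)
                       - \sum_(i < J | (j < i)%N) adjoint (B i) (pold i))%R
  + conjugate (G j) q.

Definition ssc_run (p : nat -> forall j, topdual (W j)) :=
  forall (n : nat) (j : 'I_J),
    is_argmin (ssc_objective (p n.+1) (p n)) (p n.+1 j).

Definition prs_method : method V := {|
  config := V * ('I_J -> topdual V) ;
  generates := fun c x => exists u r,
    [/\ u 0%N = c.1, r 0%N = c.2, prs_run u r & forall n, x n = u (n * J)%N]
|}.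

Definition ssc_method : method (forall j, topdual (W j)) := {|
  config := forall j, topdual (W j) ;
  generates := fun c p => p 0%N = c /\ ssc_run p
|}.

Definition dualization (M : method V) (N : method (forall j, topdual (W j))) :=
  forall c : config N, exists c' : config M,
    (exists u, generates c' u) /\
    forall u p, generates c' u -> generates c p ->
      forall n, (1 <= n)%N ->
        subdifferential (EFin \o F) (u n) (neg_adjoint_sum (p n)).

End algorithms.

(* Main.v *)
Require Import Defs.
From HB Require Import structures.
From mathcomp Require Import all_boot all_order all_algebra.
From mathcomp Require Import all_classical all_reals all_analysis.
From mathcomp Require Import ring lra.

(** The relation u = (F^* )'(q) is equivalent to F'(u) = q, so the claim
    compares F'(u) with the dual residual, minus the sum of the B_j^* p_j. For a
    strongly convex F with Lipschitz F', a minimizing sequence of F - q is Cauchy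
    and its limit u satisfies F'(u) = q ([dualdiff_surjective]); strong convexity
    also squeezes F^*(p) - F^*(q) - (p - q, u) between 0 and
    |p - q|^2 / (2 mu), so that F^* is differentiable at q with derivative u
    ([is_conjdiff_gradient]), and uniqueness of derivatives gives the converse
    ([conjdiff_gradient]).

    Each local step of the primal method then has the form
    min_v F(v) - (c, v) + G_j (B_j v), with c = F'(u_old) - r_j, and each local
    step of the dual method the form min_q F^*(c - B_j^* q) + G_j^*(q), where c
    is the sum of the terms - B_i^* p_i over i <> j. These two problems are a
    Fenchel-Rockafellar pair as soon as the two constants c agree. The
    qualification condition provides one dual solution without duality gap; every
    dual minimizer p then has the same value, so the Fenchel-Young inequality is
    an equality at (u_new, p), which says that u_new maximizes
    (c - B_j^* p, v) - F(v) ([dual_argmin_maximizes]), that is,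
    F'(u_new) = c - B_j^* p ([prs_dual_step]).

    It remains to propagate, by induction along a sweep ([prs_dual_sweep]) and
    then over the sweeps ([prs_dual_iterates]), the invariant that F'(u) is the
    current dual residual and r_j = - B_j^* p_j: it makes the two
    constants c agree at the next step. *)

Set Implicit Arguments.
Unset Strict Implicit.
Unset Printing Implicit Defensive.

Import Order.TTheory GRing.Theory Num.Theory.
Import numFieldNormedType.Exports.

Local Open Scope classical_set_scope.
Local Open Scope ring_scope.

(** * Duality pairing *)

(** The values of a functional, typed in [R] instead of the regular module
    [R^o], so that the ordered-field operations apply to them. *)
Definition pairing (R : realType) (V : normedModType R) (p : topdual V)
  (v : V) : R := p v.

Section pairing_lemmas.
Context {R : realType} {V : normedModType R}.
Implicit Types (p q : topdual V) (v w : V).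

Lemma pairing0r p : pairing p 0 = 0.
Proof. exact: linear0. Qed.

Lemma pairingNr p v : pairing p (- v) = - pairing p v.
Proof. exact: linearN. Qed.

Lemma pairingDr p v w : pairing p (v + w) = pairing p v + pairing p w.
Proof. exact: linearD. Qed.

Lemma pairingBr p v w : pairing p (v - w) = pairing p v - pairing p w.
Proof. exact: linearB. Qed.

Lemma pairingZr p t v : pairing p (t *: v) = t * pairing p v.
Proof. exact: linearZ. Qed.

Lemma pairingNl p v : pairing (- p) v = - pairing p v.
Proof. by []. Qed.

Lemma pairingDl p q v : pairing (p + q) v = pairing p v + pairing q v.
Proof. by []. Qed.

Lemma pairingBl p q v : pairing (p - q) v = pairing p v - pairing q v.
Proof. by []. Qed.

Lemma pairing_ext p q : pairing p =1 pairing q -> p = q.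
Proof. by move=> pq; apply/val_inj/funext. Qed.

Lemma normr_pairing_le p v : `|pairing p v| <= `|p| * `|v|.
Proof.
have [->|v0] := eqVneq v 0; first by rewrite pairing0r !normr0 mulr0.
have nv : 0 < `|v| by rewrite normr_gt0.
have : `|pairing p (`|v|^-1 *: v)| <= `|p|.
  by apply: opnorm_ub; rewrite normrZ normfV normr_id mulVf ?gt_eqF.
by rewrite pairingZr normrM normfV normr_id ler_pdivrMl// mulrC.
Qed.

Lemma pairing_le p v : pairing p v <= `|p| * `|v|.
Proof. exact: le_trans (ler_norm _) (normr_pairing_le p v). Qed.

Lemma pairing_continuous p : continuous (pairing p : V -> R^o).
Proof. exact: blin_continuous. Qed.

Lemma pairing_adjoint (W : normedModType R) (B : blin V W) (q : topdual W) v :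
  pairing (adjoint B q) v = pairing q (B v).
Proof. by []. Qed.

End pairing_lemmas.

(** The bound is sharp at [a = mu * b]: the gap is a square. *)
Lemma young (R : realFieldType) (mu a b : R) : 0 < mu ->
  a * b <= a ^+ 2 / (2 * mu) + mu / 2 * b ^+ 2.
Proof.
move=> mu0; rewrite -subr_ge0.
have -> : a ^+ 2 / (2 * mu) + mu / 2 * b ^+ 2 - a * b
    = (a - mu * b) ^+ 2 / (2 * mu) by field; rewrite gt_eqF.
by rewrite divr_ge0 ?sqr_ge0// mulr_ge0 // ltW.
Qed.

Lemma fenchel_young (R : realType) (V : normedModType R) (f : V -> R)
  (p : topdual V) (v : V) :
  ((pairing p v - f v)%:E <= conjugate (EFin \o f) p)%E.
Proof. by apply: ereal_sup_ubound; exists v. Qed.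

(** * The gradient of a smooth strongly convex function and its inverse *)

Section derivative_of_strongly_convex.
Context {R : realType} {V : completeNormedModType R}.
(* The derivative enters only through strong convexity and Lipschitz
   continuity, so it is kept as an abstract field [F'] of functionals. *)
Variables (F : V -> R) (F' : V -> topdual V) (mu L : R).
Hypotheses (mu0 : 0 < mu) (L0 : 0 < L).
Hypothesis sc : forall v w : V,
  F w + pairing (F' w) (v - w) + mu / 2 * `|v - w| ^+ 2 <= F v.
Hypothesis sm : forall v w : V, `|F' v - F' w| <= L * `|v - w|.

Lemma tangent_le (v w : V) : F w + pairing (F' w) (v - w) <= F v.
Proof.
apply: le_trans (sc v w).
by rewrite lerDl mulr_ge0 ?sqr_ge0// divr_ge0 ?ltW.
Qed.

(** Fermat's rule. For [w = u + t h], maximality at [u] and the tangent inequality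
    at [w] give [t * q h <= F w - F u <= t * F' w h], and [F' w h] tends to
    [F' u h] as [t] tends to 0. *)
Lemma maximizes_dualdiff (u : V) (q : topdual V) :
  (forall v, pairing q v - F v <= pairing q u - F u) -> F' u = q.
Proof.
move=> umax.
have le h : pairing q h <= pairing (F' u) h.
  rewrite -subr_ge0; apply/ler_addgt0Pr => e e0.
  (* small enough that [F' w h] is within [e] of [F' u h]; the summand 1
     covers the case [h = 0] *)
  pose t := e / (L * `|h| ^+ 2 + 1).
  have d0 : 0 < L * `|h| ^+ 2 + 1.
    by rewrite ltr_wpDl// mulr_ge0 ?sqr_ge0// ltW.
  have t0 : 0 < t by rewrite divr_gt0.
  have tL : t * (L * `|h| ^+ 2) <= e.
    rewrite /t mulrAC ler_pdivrMr// ler_pM2l// lerDl; exact: ler01.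
  have [w wu] : exists w, w - u = t *: h.
    by exists (u + t *: h); rewrite addrAC subrr add0r.
  have smh : pairing (F' w) h - pairing (F' u) h <= e.
    rewrite -pairingBl; apply: (le_trans (pairing_le _ _)); apply: le_trans tL.
    have -> : t * (L * `|h| ^+ 2) = L * (t * `|h|) * `|h| by ring.
    by apply: ler_wpM2r => //; have := sm w u; rewrite wu normrZ gtr0_norm.
  have ub : t * pairing q h <= F w - F u.
    by rewrite -pairingZr -wu pairingBr; have := umax w; lra.
  have conv : F w - F u <= t * pairing (F' w) h.
    by have := tangent_le u w; rewrite -opprB wu pairingNr pairingZr; lra.
  have qw : pairing q h <= pairing (F' w) h.
    by rewrite -(ler_pM2l t0); exact: le_trans conv.
  by lra.
apply: pairing_ext => h; apply/eqP; rewrite eq_le le andbT.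
by have := le (- h); rewrite !pairingNr lerN2.
Qed.

(** The functionals [F' u] and [F' w] alone separate [u] from [w], by strong
    monotonicity of [F']. *)
Lemma dual_separates (u w : V) : (forall p, pairing p u = pairing p w) -> u = w.
Proof.
move=> uw; have h1 := sc u w; have := sc w u.
rewrite -(opprB u w) normrN pairingNr => h2.
have uw0 p : pairing p (u - w) = 0 by rewrite pairingBr uw subrr.
rewrite uw0 in h1; rewrite uw0 in h2.
have : mu / 2 * `|u - w| ^+ 2 <= 0 by lra.
rewrite pmulr_rle0 ?divr_gt0// => n0; apply/subr0_eq/normr0_eq0/eqP.
by rewrite -sqrf_eq0 eq_le n0 sqr_ge0.
Qed.

(** The direct method: strong convexity bounds [F - q] from below and, compared at
    midpoints, makes every minimizing sequence Cauchy; by completeness and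
    continuity its limit is a minimizer, where Fermat's rule applies. *)
Lemma dualdiff_surjective (q : topdual V) :
  continuous (F : V -> R^o) -> exists u, F' u = q.
Proof.
move=> cF.
pose Phi v := F v - pairing q v.
pose E := range Phi.
have lbE : has_lbound E.
  exists (F 0 - `|F' 0 - q| ^+ 2 / (2 * mu)) => _ [v _ <-].
  have := sc v 0; rewrite subr0 /Phi.
  have := pairing_le (q - F' 0) v; rewrite distrC pairingBl.
  have := young `|F' 0 - q| `|v| mu0.
  lra.
have infE : has_inf E by split => //; exists (Phi 0); exists 0.
have minE v : inf E <= Phi v by apply: ge_inf => //; exists v.
have /choice[x xP] n : exists v, Phi v < inf E + n.+1%:R^-1.
  have [|_ [v _ <-] vlt] := @inf_adherent _ E n.+1%:R^-1 _ infE.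
    by rewrite invr_gt0.
  by exists v.
(* add the strong convexity inequalities of [v] and [w] at their midpoint [m]:
   the first-order terms cancel *)
have mid v w : mu / 4 * `|v - w| ^+ 2 <= Phi v + Phi w - 2 * inf E.
  pose m := 2^-1 *: (v + w).
  have vm : v - m = 2^-1 *: (v - w).
    rewrite -[v in LHS]scale1r [X in X *: _](splitr 1) div1r /m.
    by rewrite scalerDl [2^-1 *: (v + w)]scalerDr scalerBr addrKA.
  have wm : w - m = - (2^-1 *: (v - w)).
    rewrite -[w in LHS]scale1r [X in X *: w](splitr 1) div1r /m (addrC v).
    rewrite scalerDl [2^-1 *: (w + v)]scalerDr scalerBr opprB.
    by rewrite addrKA.
  have := minE m; have := sc v m; have := sc w m.
  rewrite vm wm normrN normrZ pairingNr gtr0_norm// exprMn /Phi.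
  rewrite [pairing q m]pairingZr pairingDr.
  lra.
have cx : cvg (x @ \oo).
  apply/cauchy_cvgP/cauchyP => e e0.
  have d0 : 0 < mu / 8 * e ^+ 2 by rewrite mulr_gt0 ?exprn_gt0// divr_gt0.
  have [N _ NP] : \forall n \near \oo, n.+1%:R^-1 < mu / 8 * e ^+ 2.
    exact: (cvgr_lt 0 cvg_harmonic).
  exists (x N), N => // n /= Nn; rewrite -ball_normE /=.
  rewrite -(@ltr_pXn2r _ 2)// ?nnegrE ?(ltW e0)//.
  have := mid (x N) (x n); have := xP N; have := xP n.
  have : n.+1%:R^-1 < mu / 8 * e ^+ 2 := NP n Nn.
  have : N.+1%:R^-1 < mu / 8 * e ^+ 2 := NP N (leqnn N).
  set a := N.+1%:R^-1; set b := n.+1%:R^-1; move: a b => a b h1 h2 h3 h4 h5.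
  rewrite -(@ltr_pM2l _ (mu / 4)) ?divr_gt0//; lra.
set u := lim (x @ \oo) in cx.
exists u; apply: maximizes_dualdiff => v.
suff : Phi u <= inf E by have := minE v; rewrite /Phi; lra.
have cPhi : (Phi \o x) n @[n --> \oo] --> (Phi u : R^o).
  apply: (@cvgB _ R^o).
    exact: (cvg_comp _ _ cx (cF _)).
  exact: (cvg_comp _ _ cx (@pairing_continuous _ _ q _)).
have cinf : inf E + n.+1%:R^-1 @[n --> \oo] --> inf E.
  rewrite -[X in _ --> X]addr0; apply: cvgD; first exact: cvg_cst.
  exact: cvg_harmonic.
apply: (ler_cvg_to cPhi cinf); apply: nearW => n; exact/ltW/xP.
Qed.

Local Notation conj := (conjugate (EFin \o F)).

Lemma conjugate_le (q : topdual V) (c : R) :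
  (forall v, pairing q v - F v <= c) -> (conj q <= c%:E)%E.
Proof.
by move=> h; apply: ge_ereal_sup => _ [v _ <-]; rewrite lee_fin; exact: h.
Qed.

(** The remainder [d] is nonnegative by the Fenchel-Young inequality; its
    quadratic bound is the smoothness of the conjugate that is dual to the strong
    convexity of [F]. With [p = q] it gives the value of the conjugate at [q]. *)
Lemma conjugate_near (u : V) (q : topdual V) : F' u = q -> forall p : topdual V,
  exists2 d : R, conj p = (pairing p u - F u + d)%:E &
    0 <= d <= `|p - q| ^+ 2 / (2 * mu).
Proof.
move=> uq p; set D := `|p - q| ^+ 2 / (2 * mu).
have lo : ((pairing p u - F u)%:E <= conj p)%E := fenchel_young F p u.
have hi : (conj p <= (pairing p u - F u + D)%:E)%E.
  apply: conjugate_le => v; have := sc v u; rewrite uq.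
  have := pairing_le (p - q) (v - u); rewrite pairingBl !pairingBr.
  have := young `|p - q| `|v - u| mu0; rewrite -/D; lra.
case: (conj p) lo hi => [c| |] //; rewrite !lee_fin => lo hi.
exists (c - (pairing p u - F u)); first by congr EFin; ring.
by apply/andP; split; lra.
Qed.

(** The quadratic remainder of [conjugate_near] is negligible against [p - q]. *)
Lemma is_conjdiff_gradient (u : V) (q : topdual V) : F' u = q ->
  is_conjdiff F q u.
Proof.
move=> uq; have near_q := conjugate_near uq; split.
  have nq : Filter (nbhs q) by exact: nbhs_filter.
  by apply: (@filterE _ (nbhs q) nq) => p; have [d ->] := near_q p.
have lin : linear (fun p : topdual V => p u : R^o) by [].
pose ev : {linear topdual V -> R^o} :=
  HB.pack (fun p : topdual V => p u : R^o) (GRing.isLinear.Build _ _ _ _ _ lin).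
have cev : continuous ev.
  apply/linear_bounded_continuous/bounded_funP => r; exists (r * `|u|) => p pr.
  exact: le_trans (normr_pairing_le p u) (ler_wpM2r _ pr).
set f := _ \o _.
have fD : f \o shift q = cst (f q) + ev +o_ 0 id.
  apply/eqaddoP => e e0.
  near=> h.
  have [d hd /andP[d0 dle]] := near_q (h + q).
  have fqh : f (h + q) = pairing (h + q) u - F u + d by rewrite /f /= hd.
  have fq : f q = pairing q u - F u.
    have [d1 hd1] := near_q q.
    rewrite subrr normr0 expr0n mul0r -eq_le => /eqP d10.
    by rewrite /f /= hd1 -d10 addr0.
  have -> : (f \o shift q - (cst (f q) + ev)) h = d.
    transitivity (f (h + q) - (f q + pairing h u)) => //.
    by rewrite fqh fq pairingDl; ring.
  rewrite ger0_norm//; apply: (le_trans dle); rewrite addrK.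
  rewrite ler_pdivrMr ?mulr_gt0// expr2 mulrAC ler_wpM2r//.
  near: h; apply: nbhs0_le; by rewrite !mulr_gt0.
have dfE : 'd f q = ev :> (_ -> _) by exact: diff_unique.
split => //; apply/diff_locallyP; split; rewrite dfE //.
Unshelve. all: by end_near. Qed.

(** [q] is the gradient at some [w], hence the conjugate has derivative [w] at
    [q]; derivatives being unique, all functionals agree on [u] and [w]. *)
Lemma conjdiff_gradient (u : V) (q : topdual V) : continuous (F : V -> R^o) ->
  is_conjdiff F q u -> F' u = q.
Proof.
move=> cF [_ du]; have [w wq] := dualdiff_surjective q cF.
have [_ dw] := is_conjdiff_gradient wq.
suff -> : u = w by [].
apply: dual_separates => p.
have du' := @diff_val _ _ _ _ _ _ _ du.
have dw' := @diff_val _ _ _ _ _ _ _ dw.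
by have := congr1 (@^~ p) (etrans (esym du') dw').
Qed.

End derivative_of_strongly_convex.

(** * Fenchel-Rockafellar extremality *)

Section fenchel_rockafellar.
Context {R : realType} {V W : normedModType R}.
Implicit Types (f : V -> R) (g : W -> \bar R) (B : blin V W).
Local Open Scope ereal_scope.

(** A subgradient [pb] of the perturbation function at 0 is a dual solution
    without duality gap. A dual minimizer [p] does at least as well as [pb], so the
    Fenchel-Young inequalities of [f] and [g] at [u] and [B u], whose sum bounds
    the dual value from below, are both equalities for [p]; the equality for [f]
    is the maximality stated here. *)
Lemma dual_argmin_maximizes f g B (u : V) (p : topdual W) :
  qualified (EFin \o f) g B ->
  is_argmin (fun v => (f v)%:E + g (B v)) u ->
  is_argmin (fun q => conjugate (EFin \o f) (- adjoint B q)%R + conjugate g q)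
    p ->
  forall v, (pairing (- adjoint B p) v - f v
    <= pairing (- adjoint B p) u - f u)%R.
Proof.
move=> [pb [hfin hsub]] umin pmin.
pose h w := ereal_inf [set (f v)%:E + g (B v + w)%R | v in [set: V]].
have h0 : h 0%R = (f u)%:E + g (B u).
  apply/eqP; rewrite eq_le; apply/andP; split.
    by apply: ereal_inf_lbound; exists u => //; rewrite addr0.
  by apply: le_ereal_inf_tmp => _ [v _ <-]; rewrite addr0; exact: umin.
have [c gu] : exists c, g (B u) = c%:E.
  have : h 0%R \is a fin_num := hfin; rewrite h0.
  by case: (g (B u)) => [c| |] //; exists c.
(* the subgradient inequality for the perturbation [w = y - B v] decouples [v]
   from [y] *)
have key v y : ((f u + c + pairing pb (y - B v))%:E <= (f v)%:E + g y).
  have := hsub (y - B v)%R; rewrite -/(h 0%R) h0 gu subr0 => /le_trans; apply.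
  by apply: ereal_inf_lbound; exists v => //; rewrite (addrC (B v)) subrK.
have conj_g : conjugate g pb <= (pairing pb (B u) - c)%:E.
  apply: ge_ereal_sup => _ [y _ <-].
  have := key u y; rewrite pairingBr; case: (g y) => [a| |] /=.
  - by rewrite !lee_fin /pairing; lra.
  - by rewrite leNye.
  - by rewrite addeNy leeNy_eq.
have conj_f : conjugate (EFin \o f) (- adjoint B pb)%R
    <= (- pairing pb (B u) - f u)%:E.
  apply: ge_ereal_sup => _ [v _ <-].
  have := key v (B u); rewrite gu pairingBr !lee_fin.
  rewrite -[(- adjoint B pb)%R v]/(- pairing pb (B v))%R; lra.
have {pmin} := le_trans (pmin pb) (leeD conj_f conj_g).
have lo_g : (pairing p (B u) - c)%:E <= conjugate g p.
  by apply: ereal_sup_ubound; exists (B u) => //; rewrite gu.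
have lo_f v := fenchel_young f (- adjoint B p)%R v.
case: (conjugate _ _) lo_f => [a| |] lo_f //; last by have := lo_f u.
  case: (conjugate g p) lo_g => [b| |] // lo_g hab v.
  have := lo_f v; have := lo_f u.
  move: lo_g hab; rewrite !lee_fin !pairingNl !pairing_adjoint; lra.
by case: (conjugate g p) lo_g.
Qed.

(** The primal subproblems involve [F] perturbed by an affine function; in the
    conjugate this becomes a translation, the form of the dual subproblems. *)
Lemma conjugate_affine f (c : topdual V) (k : R) (q : topdual V) :
  conjugate (EFin \o f) (q + c)%R =
  conjugate (fun v => (f v - pairing c v + k)%:E) q + k%:E.
Proof.
have shift v : (pairing q v - (f v - pairing c v + k) + k =
    pairing (q + c) v - f v)%R by rewrite pairingDl; ring.
apply/eqP; rewrite eq_le; apply/andP; split.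
  apply: ge_ereal_sup => _ [v _ <-]; rewrite -leeBlDr//.
  apply: ereal_sup_ubound; exists v => //.
  have shift' : (pairing q v - (f v - pairing c v + k) =
    pairing (q + c) v - f v - k)%R by rewrite -shift addrK.
  by transitivity (pairing q v - (f v - pairing c v + k))%:E; rewrite // shift'.
rewrite -leeBrDr//; apply: ge_ereal_sup => _ [v _ <-]; rewrite leeBrDr//.
by apply: ereal_sup_ubound; exists v; rewrite // -EFinB -EFinD shift.
Qed.

End fenchel_rockafellar.

(** * Propagation of the duality relation along the iterations *)

Lemma telescope_update (M : zmodType) (a b c : M) :
  - a + (c - b) - (c - a) = - b.
Proof. by rewrite opprB addrACA addNr add0r addrAC subrr add0r. Qed.

Section sweep.
Context {R : realType} {V : hilbertType R} {J : nat}.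
Context {W : 'I_J -> hilbertType R}.
Variables (F : V -> R) (G : forall j, W j -> \bar R).
Variable B : forall j, blin V (W j).
Arguments G : clear implicits.
Hypothesis F_strong : strongly_convex F.
Hypothesis F_smooth : smooth F.
Implicit Types p : forall j, topdual (W j).
Local Notation F' := (dualdiff F).

Lemma prs_smooth_partE (u : V) (rj : topdual V) (v : V) :
  prs_smooth_part F u rj v =
  (F v - pairing (F' u - rj) v + (pairing (F' u) u - F u))%:E.
Proof.
rewrite /prs_smooth_part /bregman; congr EFin.
rewrite -[rj v]/(pairing rj v) -[F' u (v - u)]/(pairing (F' u) (v - u)).
by rewrite pairingBr pairingBl; ring.
Qed.

(** A local primal problem and a local dual problem are a Fenchel-Rockafellar pair
    when the dual one is centred at [c = F' u0 - rj], with [u0] and [rj] the data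
    of the primal one. *)
Lemma prs_dual_step (j : 'I_J) (u0 u : V) (rj c : topdual V)
    (p : topdual (W j)) :
  qualified (prs_smooth_part F u0 rj) (G j) (B j) ->
  F' u0 - rj = c ->
  is_argmin (prs_objective F G B j u0 rj) u ->
  is_argmin (fun q => conjugate (EFin \o F) (c - adjoint (B j) q)%R
    + conjugate (G j) q)%E p ->
  F' u = c - adjoint (B j) p.
Proof.
move=> qual <- {c} umin pmin.
pose f v := F v - pairing (F' u0 - rj) v + (pairing (F' u0) u0 - F u0).
have fE : prs_smooth_part F u0 rj = EFin \o f.
  by apply/funext => v; exact: prs_smooth_partE.
rewrite fE in qual.
have {}umin : is_argmin (fun v => (f v)%:E + G j (B j v))%E u.
  by move=> v; have := umin v; rewrite /prs_objective fE.
have {}pmin : is_argmin (fun q => conjugate (EFin \o f) (- adjoint (B j) q)%R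
    + conjugate (G j) q)%E p.
  move=> q; have := pmin q.
  rewrite ![_ - adjoint _ _]addrC.
  rewrite !(conjugate_affine _ _ (pairing (F' u0) u0 - F u0)).
  by rewrite ![(_ + (_ - _)%:E + _)%E]addeAC leeD2rE.
have umax := dual_argmin_maximizes qual umin pmin.
have [mu mu0 sc] := F_strong; have [L L0 sm] := F_smooth.
apply: (maximizes_dualdiff mu0 L0 sc sm) => v; have := umax v.
by rewrite /f [_ - adjoint _ _]addrC !pairingDl; lra.
Qed.

(** The part of the dual residual that stays fixed while component [j] of [p] is
    being replaced by that of [p']. *)
Definition ssc_rest p p' (j : 'I_J) : topdual V :=
  - \sum_(i < J | (i < j)%N) adjoint (B i) (p' i)
  - \sum_(i < J | (j < i)%N) adjoint (B i) (p i).

(** The dual residual after the first [m] substeps of the sweep from [p] to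
    [p']. *)
Definition ssc_state p p' (m : nat) : topdual V :=
  - \sum_(i < J | (i < m)%N) adjoint (B i) (p' i)
  - \sum_(i < J | (m <= i)%N) adjoint (B i) (p i).

Lemma ssc_state0 p p' : ssc_state p p' 0 = neg_adjoint_sum B p.
Proof. by rewrite /ssc_state big_pred0// oppr0 add0r. Qed.

Lemma ssc_stateJ p p' : ssc_state p p' J = neg_adjoint_sum B p'.
Proof.
rewrite /ssc_state [X in _ - X]big_pred0 ?subr0; last first.
  by move=> i; rewrite leqNgt ltn_ord.
by congr (- _); apply: eq_bigl => i; rewrite ltn_ord.
Qed.

Lemma ssc_state_before p p' (j : 'I_J) :
  ssc_state p p' j = ssc_rest p p' j - adjoint (B j) (p j).
Proof.
rewrite /ssc_state /ssc_rest -addrA; congr (_ + _).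
rewrite (bigD1 j)//= opprD addrC; congr (_ - _).
by apply: eq_bigl => i; rewrite ltn_neqAle andbC eq_sym -val_eqE.
Qed.

Lemma ssc_state_after p p' (j : 'I_J) :
  ssc_state p p' j.+1 = ssc_rest p p' j - adjoint (B j) (p' j).
Proof.
rewrite /ssc_state /ssc_rest addrAC; congr (_ + _).
rewrite (bigD1 j)//= opprD addrC; congr (_ - _).
by apply: eq_bigl => i; rewrite ltnS [RHS]ltn_neqAle andbC -val_eqE.
Qed.

Lemma ssc_objectiveE p p' (j : 'I_J) (q : topdual (W j)) :
  ssc_objective F G B p' p q =
  (conjugate (EFin \o F) (ssc_rest p p' j - adjoint (B j) q)%R
   + conjugate (G j) q)%E.
Proof. by rewrite /ssc_objective /ssc_rest [_ - adjoint _ q]addrC addrA. Qed.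

Hypothesis local_qual : forall j (u : V) (rj : topdual V),
  qualified (prs_smooth_part F u rj) (G j) (B j).

(** By [r0], subtracting [r n j] from the residual removes the old component [j],
    so the primal subproblem sees exactly the residual [ssc_rest] of the dual one
    and [prs_dual_step] inserts the new component. *)
Lemma prs_dual_sweep (u : nat -> V) (r : nat -> 'I_J -> topdual V)
    (p : nat -> forall j, topdual (W j)) (n : nat) :
  prs_run F G B u r -> ssc_run F G B p ->
  F' (u (n * J)%N) = neg_adjoint_sum B (p n) ->
  (forall j, r n j = - adjoint (B j) (p n j)) ->
  forall m, (m <= J)%N -> F' (u (n * J + m)%N) = ssc_state (p n) (p n.+1) m.
Proof.
move=> urun prun u0 r0; elim=> [_|m IH mJ]; first by rewrite addn0 ssc_state0.
pose j := Ordinal mJ; have [umin _] := urun n j.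
have before : F' (u (n * J + j)%N) - r n j = ssc_rest (p n) (p n.+1) j.
  rewrite [F' _](IH (ltnW mJ)) -[m]/(j : nat) ssc_state_before.
  by rewrite r0 opprK subrK.
have pmin : is_argmin (fun q => conjugate (EFin \o F)
    (ssc_rest (p n) (p n.+1) j - adjoint (B j) q)%R + conjugate (G j) q)%E
    (p n.+1 j).
  by move=> q; have := prun n j q; rewrite !ssc_objectiveE.
have := prs_dual_step (local_qual j _ _) before umin pmin.
by rewrite -ssc_state_after.
Qed.

Lemma prs_dual_iterates (u : nat -> V) (r : nat -> 'I_J -> topdual V)
    (p : nat -> forall j, topdual (W j)) :
  prs_run F G B u r -> ssc_run F G B p ->
  F' (u 0%N) = neg_adjoint_sum B (p 0%N) ->
  (forall j, r 0%N j = - adjoint (B j) (p 0%N j)) ->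
  forall n, F' (u (n * J)%N) = neg_adjoint_sum B (p n) /\
    forall j, r n j = - adjoint (B j) (p n j).
Proof.
move=> urun prun u0 r0; elim=> [|n [un rn]]; first by rewrite mul0n.
have sweep := prs_dual_sweep urun prun un rn; split.
  by rewrite mulSn addnC sweep// ssc_stateJ.
move=> j; have [_ ->] := urun n j.
rewrite sweep ?ltn_ord// sweep ?(ltnW (ltn_ord j))//.
by rewrite ssc_state_after ssc_state_before rn telescope_update.
Qed.

End sweep.

(** * Existence of primal runs *)

Section prs_existence.
Context {R : realType} {V : hilbertType R} {J : nat}.
Context {W : 'I_J -> hilbertType R}.
Variables (F : V -> R) (G : forall j, W j -> \bar R).
Variable B : forall j, blin V (W j).

(** One recursion over all substeps [k = n * J + j], on the current iterate together
    with the vector of the [r_j]; substep [k] only changes the entry [k %% J] of that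
    vector, so the entry [j] is constant in a sweep except at substep [j]. *)
Lemma prs_run_exists (J_gt0 : (0 < J)%N) (u0 : V) (r0 : 'I_J -> topdual V) :
  (forall j (u : V) (rj : topdual V),
    exists v, is_argmin (prs_objective F G B j u rj) v) ->
  exists u r, [/\ u 0%N = u0, r 0%N = r0 & prs_run F G B u r].
Proof.
move=> solv.
have /choice[sol solP] (x : 'I_J * V * topdual V) : exists v : V,
  is_argmin (prs_objective F G B x.1.1 x.1.2 x.2) v by exact: solv.
pose idx k : 'I_J := Ordinal (ltn_pmod k J_gt0).
pose step k (s : V * ('I_J -> topdual V)) :=
  let v := sol (idx k, s.1, s.2 (idx k)) in
  (v, fun i => if i == idx k
    then s.2 i + dualdiff F v - dualdiff F s.1 else s.2 i).
pose st := fix st k := if k is k'.+1 then step k' (st k') else (u0, r0).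
have stS k : st k.+1 = step k (st k) by [].
have st0 : st 0%N = (u0, r0) by [].
move: st stS st0 => st stS st0.
have idxE n (j : 'I_J) : idx (n * J + j)%N = j.
  by apply: val_inj; rewrite /= modnMDl modn_small.
have untouched n (j : 'I_J) m : (m < J)%N -> m != j ->
    (st (n * J + m.+1)%N).2 j = (st (n * J + m)%N).2 j.
  move=> mJ mj; rewrite addnS stS /step [idx _](idxE n (Ordinal mJ)) /=.
  by rewrite -val_eqE /= eq_sym (negbTE mj).
have before n (j : 'I_J) m : (m <= j)%N ->
    (st (n * J + m)%N).2 j = (st (n * J)%N).2 j.
  elim: m => [|m IH] mj; first by rewrite addn0.
  by rewrite untouched ?IH ?(ltnW mj)// ?(ltn_trans mj)// neq_ltn mj.
have after n (j : 'I_J) m : (j < m)%N -> (m <= J)%N ->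
    (st (n * J + m)%N).2 j = (st (n * J + j.+1)%N).2 j.
  elim: m => // m IH; rewrite ltnS leq_eqVlt => /predU1P[<- //|jm] mJ.
  by rewrite untouched ?IH ?(ltnW mJ)// neq_ltn jm orbT.
exists (fun k => (st k).1), (fun n => (st (n * J)%N).2).
split; rewrite ?mul0n ?st0// => n j; split.
  rewrite addnS stS /step idxE /= -[(st (n * J)%N).2 j](before n j j)//.
  exact: solP.
rewrite mulSn addnC after// -[(st (n * J)%N).2 j](before n j j)//.
by rewrite addnS stS /step idxE /= eqxx.
Qed.

End prs_existence.

(** * Dualization *)

Theorem theorem5p1 (R : realType) (V : hilbertType R) (J : nat)
    (W : 'I_J -> hilbertType R) (B : forall j, blin V (W j))
    (G : forall j, W j -> \bar R) (F : V -> R)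
    (J_gt0 : (0 < J)%N)
    (G_proper : forall j, proper_function (G j))
    (G_convex : forall j, econvex (G j))
    (G_lsc : forall j, lower_semicontinuous (G j))
    (F_diff : forall v : V, differentiable (F : V -> R^o) v)
    (F_convex : convex_function (setT : set (convex_lmodType V)) F)
    (F_strong : strongly_convex F)
    (F_smooth : smooth F)
    (prs_solvable : forall j (u : V) (rj : topdual V),
      exists v, is_argmin (prs_objective F G B j u rj) v)
    (ssc_solvable : forall j (pnew pold : forall i, topdual (W i)),
      exists q, is_argmin (@ssc_objective _ _ _ _ F G B j pnew pold) q)
    (primal_qual : primal_qualified F G B)
    (local_qual : forall j (u : V) (rj : topdual V),
      qualified (prs_smooth_part F u rj) (G j) (B j)) :
  dualization F B (prs_method F G B) (ssc_method F G B) /\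
  forall (u : nat -> V) (r : nat -> 'I_J -> topdual V)
      (p : nat -> forall j, topdual (W j)),
    prs_run F G B u r -> ssc_run F G B p ->
    is_conjdiff F (neg_adjoint_sum B (p 0%N)) (u 0%N) ->
    (forall j, r 0%N j = - adjoint (B j) (p 0%N j)) ->
    forall n, (1 <= n)%N ->
      is_conjdiff F (neg_adjoint_sum B (p n)) (u (n * J)%N) /\
      (forall j, r n j = - adjoint (B j) (p n j)).
Proof.

have [mu mu0 sc] := F_strong; have [L L0 sm] := F_smooth.
have cF : continuous (F : V -> R^o).
  by move=> v; exact: differentiable_continuous.
split=> [c|u r p urun prun u0 r0 n _].
  have [u0 u0E] := dualdiff_surjective mu0 L0 sc sm (neg_adjoint_sum B c) cF.
  exists (u0, fun j => - adjoint (B j) (c j)); split.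
    have [u [r [uE rE urun]]] := prs_run_exists J_gt0 u0
      (fun j => - adjoint (B j) (c j)) prs_solvable.
    by exists (fun n => u (n * J)%N), u, r.
  move=> x p [u [r [/= uE rE urun xE]]] [p0 prun] n _.
  have [|j|un _] := prs_dual_iterates F_strong F_smooth local_qual urun prun _ _ n.
  - by rewrite uE p0.
  - by rewrite rE p0.
  split=> // y; rewrite xE -un lee_fin.
  exact: tangent_le mu0 sc y (u (n * J)%N).
have [|un rn] := prs_dual_iterates F_strong F_smooth local_qual urun prun _ r0 n.
  exact: (conjdiff_gradient mu0 L0 sc sm cF u0).
by split=> //; exact: (is_conjdiff_gradient mu0 sc un).
Qed.
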